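(* Let $n\geq 3$ be an integer, let $\mathbf{A}$ and $\mathbf{A}'$ be affine spaces of dimension $n$, and let $f$ be a surjective map from the set of lines of $\mathbf{A}$ onto the set of lines of $\mathbf{A}'$ which maps intersecting lines to intersecting lines, i.e. for all lines $a,b$ of $\mathbf{A}$, $a\sim b$ implies $f(a)\sim f(b)$. Then $f$ is injective, and $f$ stems from a collineation of $\mathbf{A}$ onto $\mathbf{A}'$.
   Context: For lines $a,b$ of an affine space, $a\sim b$ means that $a$ and $b$ are different lines which have a point in common. A collineation of $\mathbf{A}$ onto $\mathbf{A}'$ is a bijection $\kappa$ from the points of $\mathbf{A}$ to the points of $\mathbf{A}'$ such that $\kappa$ and $\kappa^{-1}$ map lines onto lines (preservation of parallelism is not required as part of the definition); $f$ stems from $\kappa$ if $f(a)=\{\kappa(P) : P\in a\}$ for every line $a$ of $\mathbf{A}$ (lines being identified with their sets of points). *)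

(* Defs.v *)
From mathcomp Require Import all_boot all_algebra.
From mathcomp Require Import boolp classical_sets.
Set Implicit Arguments.
Unset Strict Implicit.
Unset Printing Implicit Defensive.
Import GRing.Theory.
Local Open Scope classical_set_scope.
Local Open Scope ring_scope.

(* An affine space of dimension n: a nonempty set of points on which an
   n-dimensional left vector space acts simply transitively.  The scalars form
   an arbitrary division ring: [GRing.field_axiom] only says that nonzero
   elements are invertible, and a [unitRingType] need not be commutative. *)
Record affineSpace (n : nat) := AffineSpace {
  scalar : unitRingType;
  scalar_division : GRing.field_axiom scalar;
  direction : vectType scalar;
  direction_dim : dim direction = n;
  point :> Type;
  point_nonempty : inhabited point;
  translate : point -> direction -> point;
  translate0 : forall P, translate P 0 = P;
  translateD : forall P u v,
    translate P (u + v) = translate (translate P u) v;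
  translate_simply_transitive : forall P Q, exists! v, translate P v = Q
}.

Definition line_through n (A : affineSpace n) (P : A) (v : direction A) : set A :=
  [set Q | exists t : scalar A, Q = translate P (t *: v)].

Definition lines n (A : affineSpace n) : set (set A) :=
  [set l | exists (P : A) (v : direction A), v != 0 /\ l = line_through P v].
Arguments lines {n} A.

(* The coercion [set_type] makes [lines A] the subtype of the sets of points
   that are lines; [val a] is the set of points of the line [a]. *)
Definition line n (A : affineSpace n) : Type := lines A.

Definition points_of n (A : affineSpace n) (a : line A) : set A := val a.

Definition meets n (A : affineSpace n) (a b : line A) : Prop :=
  a <> b /\ exists P : A, points_of a P /\ points_of b P.

Definition collineation m n (A : affineSpace m) (A' : affineSpace n)
    (kappa : A -> A') : Prop :=
  exists kappa' : A' -> A,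
    [/\ cancel kappa kappa', cancel kappa' kappa,
        forall l, lines A l -> lines A' (kappa @` l) &
        forall l, lines A' l -> lines A (kappa' @` l)].

Definition stems_from m n (A : affineSpace m) (A' : affineSpace n)
    (f : line A -> line A') (kappa : A -> A') : Prop :=
  forall a : line A, points_of (f a) = kappa @` points_of a.

(* Main.v *)
Require Import Defs.
From mathcomp Require Import all_boot.
From mathcomp Require Import all_algebra.
From mathcomp Require Import boolp classical_sets.
Require Import Defs.
Set Implicit Arguments.
Unset Strict Implicit.
Unset Printing Implicit Defensive.
Import GRing.Theory VectorInternalTheory.

(** The lines through a point P pairwise meet, so their images pairwise meet:
    either these all pass through one point, or they all lie in one plane E.
    In the second case every line d of the source would have an image meeting
    E, since d is a line through P or meets one; but a line parallel to E is an
    image, because the dimension is at least 3.  Hence f maps the star of P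
    into the star of a point kappa P ([star_to_star]).

    If kappa P = kappa Q with P <> Q, then for X off the line PQ the images of
    XP and XQ are distinct lines through kappa P and kappa X, so
    kappa X = kappa P; then all images pass through kappa P, against
    surjectivity.  So kappa is injective, f a is the line spanned by the
    kappa-images of two points of a, and kappa X lies on f a only if X lies
    on a ([kappa_reflects]).  Injectivity of f follows.

    It remains to see that kappa is onto; every line of the target is an f a
    and so contains at least two points of the range of kappa.  Assume that P'
    is outside the range.  In a plane E through P' pick a line l1 through P',
    a parallel l2 of l1, and the line l3 joining P' to some kappa X on l2.
    Their preimages a1, b, b' under f satisfy: b and b' pass through X, and
    neither meets a1, since l2 misses l1 and l3 meets l1 only in P'.  So a1, b
    and b' cannot lie in a common plane.  If the scalars of the source have an
    element besides 0 and 1, the preimage of E under kappa is a flat; it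
    contains a1, b, b', hence has dimension at least 3.  Then n - 3 further
    points generate the whole source together with it, so the range of kappa
    lies in a flat of dimension at most 2 + (n - 3) < n.  This flat misses some
    line, a contradiction ([kappa_onto_ternary]).

    Over a two-element ring every set of points is closed under lines, and the
    dimension argument breaks down.  If the target is of order 2, its lines
    have just two points, all in the range of kappa.  If only the source is of
    order 2, the star of X has 2^n - 1 lines and is mapped onto the star of
    kappa X, which has more ([no_binary_star]). *)

(** * Linear algebra over division rings *)

Section Span.
Local Open Scope ring_scope.
Variables (R : unitRingType) (V : lmodType R).

Definition subspace (W : V -> Prop) : Prop :=
  W 0 /\ forall c u v, W u -> W v -> W (c *: u + v).

(** The linear span over a possibly noncommutative ring, as the intersection of
    all subspaces containing [s]: monotonicity is then immediate. *)
Definition spanned (s : seq V) (v : V) : Prop :=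
  forall W, subspace W -> (forall x, x \in s -> W x) -> W v.

(** No vector depends on the later ones, which over a division ring is linear
    independence. *)
Fixpoint independent (s : seq V) : Prop :=
  if s is x :: s' then ~ spanned s' x /\ independent s' else True.

Lemma subspaceZ W c u : subspace W -> W u -> W (c *: u).
Proof. by move=> [W0 WD] Wu; rewrite -[_ *: _]addr0; apply: WD. Qed.

Lemma subspaceD W u v : subspace W -> W u -> W v -> W (u + v).
Proof. by move=> [W0 WD] Wu Wv; rewrite -[u]scale1r; apply: WD. Qed.

Lemma subspaceB W u v : subspace W -> W u -> W v -> W (u - v).
Proof. by move=> [W0 WD] Wu Wv; rewrite addrC -scaleN1r; apply: WD. Qed.

Lemma spanned_subspace s : subspace (spanned s).
Proof.
split=> [W [] //|c u v su sv W Wsub sW].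
by apply: (proj2 Wsub); [apply: su|apply: sv].
Qed.

Lemma mem_spanned s x : x \in s -> spanned s x.
Proof. by move=> xs W _; apply. Qed.

Lemma spanned_trans s t v :
  (forall x, x \in s -> spanned t x) -> spanned s v -> spanned t v.
Proof. by move=> st /(_ (spanned t)); apply=> //; apply: spanned_subspace. Qed.

Lemma spanned_sub s t v : {subset s <= t} -> spanned s v -> spanned t v.
Proof. by move=> st; apply: spanned_trans => x /st; apply: mem_spanned. Qed.

Lemma spanned_cons y s v :
  spanned (y :: s) v -> exists c w, spanned s w /\ v = c *: y + w.
Proof.
have sub := spanned_subspace s.
move=> /(_ (fun v => exists c w, spanned s w /\ v = c *: y + w)); apply.
  split=> [|c u1 u2 [c1 [w1 [sw1 ->]]] [c2 [w2 [sw2 ->]]]].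
    by exists 0, 0; split; [case: sub|rewrite scale0r addr0].
  exists (c * c1 + c2), (c *: w1 + w2); split; first exact: (proj2 sub).
  by rewrite scalerDr scalerDl scalerA addrACA.
move=> x; rewrite inE => /predU1P[->|xs].
  by exists 1, 0; split; [case: sub|rewrite scale1r addr0].
by exists 0, x; split; [apply: mem_spanned|rewrite scale0r add0r].
Qed.

Lemma spanned_nil v : spanned [::] v -> v = 0.
Proof.
move=> /(_ (fun v => v = 0)); apply=> //.
by split=> // c x y -> ->; rewrite scaler0 addr0.
Qed.

Lemma spanned1 x v : spanned [:: x] v -> exists c, v = c *: x.
Proof.
by move=> /spanned_cons[c [w [/spanned_nil-> ->]]]; exists c; rewrite addr0.
Qed.

Hypothesis Rdiv : GRing.field_axiom R.

Lemma scalerK_div (c : R) (v : V) : c != 0 -> c^-1 *: (c *: v) = v.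
Proof. by move=> /Rdiv cU; rewrite scalerA mulVr // scale1r. Qed.

(** Some vector of [t] has a nonzero coefficient in [x], as [x] is not spanned
    by [s] alone; [x] can take its place. *)
Lemma exchange s t x : spanned (s ++ t) x -> ~ spanned s x ->
  exists t', size t = (size t').+1 /\
    forall y, y \in s ++ t -> spanned (x :: s ++ t') y.
Proof.
move=> + nsx; elim: t => [|y t IHt]; first by rewrite cats0.
move=> styx; have [stx|nstx] := pselect (spanned (s ++ t) x).
  have [t' [szt tt']] := IHt stx; exists (y :: t'); split=> [|z].
    by rewrite /= szt.
  rewrite mem_cat inE orbCA => /predU1P[->|].
    by apply: mem_spanned; rewrite inE mem_cat mem_head !orbT.
  rewrite -mem_cat => /tt'; apply: spanned_sub => w.
  by rewrite !(inE, mem_cat) => /or3P[]->; rewrite ?orbT.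
have /spanned_cons[c [w [stw xE]]] : spanned (y :: s ++ t) x.
  apply: spanned_sub styx => z; rewrite !(inE, mem_cat).
  by case/or3P=> ->; rewrite ?orbT.
have c0 : c != 0.
  by apply/eqP => c0; apply: nstx; rewrite xE c0 scale0r add0r.
have sub := spanned_subspace (x :: s ++ t).
have up z : spanned (s ++ t) z -> spanned (x :: s ++ t) z.
  by apply: spanned_sub => u us; rewrite inE us orbT.
exists t; split=> // z.
rewrite mem_cat inE orbCA => /predU1P[->|]; last first.
  by rewrite -mem_cat => /(@mem_spanned _)/up.
have -> : y = c^-1 *: (x - w) by rewrite xE addrK scalerK_div.
apply: (subspaceZ _ sub); apply: (subspaceB sub _ (up _ stw)).
by apply: mem_spanned; exact: mem_head.
Qed.

Lemma steinitz s t : independent s -> (forall x, x \in s -> spanned t x) ->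
  exists t', (size s + size t' = size t)%N /\
    forall x, spanned t x -> spanned (s ++ t') x.
Proof.
elim: s => [|x s IHs] /=; first by exists t.
move=> [nsx frs] st; have [|t1 [szt1 tt1]] := IHs frs.
  by move=> y ys; apply: st; rewrite inE ys orbT.
have [t2 [szt2 t12]] := exchange (tt1 _ (st _ (mem_head _ _))) nsx.
exists t2; split; first by rewrite -szt1 szt2 addnS.
by move=> y /tt1; apply: spanned_trans => z /t12.
Qed.

End Span.

Section Dimension.
Local Open Scope ring_scope.
Variables (R : unitRingType) (V : vectType R).
Hypothesis Rdiv : GRing.field_axiom R.

(** The standard basis; a coordinate hyperplane separates each of its vectors
    from the others. *)
Lemma exists_basis :
  exists e : seq V, [/\ size e = dim V, independent e & forall v, spanned e v].
Proof.
pose d (i : 'I_(dim V)) : V := r2v (delta_mx 0 i).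
exists [seq d i | i <- enum 'I_(dim V)]; split.
- by rewrite size_map size_enum_ord.
- elim: (enum _) (enum_uniq 'I_(dim V)) => //= i s IHs /andP[nis us].
  split; last exact: IHs.
  move=> /(_ (fun v => v2r v 0 i = 0)); rewrite r2vK mxE !eqxx /=.
  have sub : subspace (fun v : V => v2r v 0 i = 0).
    split=> [|c u v u0 v0]; first by rewrite linear0 mxE.
    by rewrite linearP !mxE u0 v0 mulr0 addr0.
  move=> /(_ sub) xi; suff /eqP : (1 : R) = 0 by rewrite oner_eq0.
  apply: xi.
  move=> _ /mapP[j js ->]; rewrite r2vK mxE eqxx /=.
  by case: eqP js nis => // -> ->.
- move=> v W Wsub sW; rewrite -[v]v2rK (row_sum_delta (v2r v)) linear_sum /=.
  apply: (big_ind W) => [|x y|i _]; first by case: Wsub.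
    exact: subspaceD.
  rewrite linearZ; apply: subspaceZ => //; apply: sW.
  by apply: map_f; rewrite mem_enum.
Qed.

Lemma spanned_proper (s : seq V) :
  (size s < dim V)%N -> exists v, ~ spanned s v.
Proof.
move=> ltsn; apply: contrapT => /forallNP/= sV.
have [e [sze fre _]] := exists_basis.
have [|t [szt _]] := @steinitz _ _ Rdiv e s fre.
  by move=> x _; apply: contrapT; apply: sV.
by move: ltsn; rewrite -sze -szt ltnNge leq_addr.
Qed.

Lemma complete_basis (s : seq V) : independent s ->
  exists t, (size s + size t = dim V)%N /\ forall v, spanned (s ++ t) v.
Proof.
move=> frs; have [e [<- _ eV]] := exists_basis.
have [|t [szt et]] := @steinitz _ _ Rdiv s e frs; first by move=> x _.
by exists t; split=> // v; apply: et.
Qed.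

End Dimension.

Section Counting.
Local Open Scope ring_scope.

(** Counting directions: over {0, 1} there are 2^n - 1 nonzero vectors, but over
    a division ring with a further element [c] there are 2^n pairwise non-proportional
    ones, namely the nonzero 0/1-vectors and (1, c, 0, ..., 0).  A map [g] whose
    values represent all proportionality classes would turn these into 2^n
    distinct nonzero vectors of [V]. *)
Lemma no_binary_star (R R' : unitRingType) (V : vectType R) (V' : vectType R')
    (c : R') (g : V -> V') :
  GRing.field_axiom R' -> dim V' = dim V -> (1 < dim V)%N ->
  (forall t : R, t = 0 \/ t = 1) -> c != 0 -> c != 1 ->
  ~ forall w, w != 0 -> exists u s, [/\ u != 0, s != 0 & g u = s *: w].
Proof.
move=> R'div dimE dim_gt1 bin c0 c1 gP.
pose n := dim V.
pose i0 : 'I_n := Ordinal (ltnW dim_gt1); pose i1 : 'I_n := Ordinal dim_gt1.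
have i10 : (i1 == i0) = false by [].
(* The 2^n vectors are indexed by subsets of the coordinates: a nonempty set
   gives its indicator vector, and the empty set gives (1, c, 0, ..., 0). *)
pose x (T : {set 'I_n}) (i : 'I_n) : R' :=
  if T == finset.set0 then (if i == i0 then 1 else if i == i1 then c else 0)
  else (i \in T)%:R.
have x0i0 : x finset.set0 i0 = 1 by rewrite /x !eqxx.
have x0i1 : x finset.set0 i1 = c by rewrite /x !eqxx i10.
have xE T i : T != finset.set0 -> x T i = (i \in T)%:R by rewrite /x => /negPf->.
have x_neq0 T : exists i, x T i != 0.
  have [->|T0] := eqVneq T finset.set0; first by exists i0; rewrite x0i0 oner_neq0.
  by have /set0Pn[i iT] := T0; exists i; rewrite xE // iT oner_neq0.
have mul0 (s y : R') : s != 0 -> (s * y == 0) = (y == 0).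
  by move=> /R'div sU; rewrite -{1}(mulr0 s) (inj_eq (mulrI sU)).
have not_prop T (r1 r2 : R') : r1 != 0 -> T != finset.set0 ->
    ~ forall i, r1 * x finset.set0 i = r2 * x T i.
  move=> r10 T0 pr; move: (pr i0) (pr i1).
  rewrite x0i0 x0i1 !xE // mulr1.
  case: (i0 \in T); last by rewrite mulr0 => /eqP; rewrite (negPf r10).
  rewrite mulr1 => <-; case: (i1 \in T) => /eqP; last first.
    by rewrite mulr0 mul0 // (negPf c0).
  by rewrite (inj_eq (mulrI (R'div _ r10))) (negPf c1).
have x_prop T1 T2 (r1 r2 : R') : r1 != 0 -> r2 != 0 ->
    (forall i, r1 * x T1 i = r2 * x T2 i) -> T1 = T2.
  move=> r10 r20 pr.
  have [T10|T10] := eqVneq T1 finset.set0; have [T20|T20] := eqVneq T2 finset.set0.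
  - by rewrite T10.
  - by case: (not_prop T2 r1 r2) => // i; rewrite -T10.
  - by case: (not_prop T1 r2 r1) => // i; rewrite -T20.
  apply/setP => i; have : (r1 * x T1 i == 0) = (r2 * x T2 i == 0) by rewrite pr.
  rewrite !mul0 // !xE //.
  by do 2 case: (i \in _); rewrite ?oner_eq0 ?eqxx.
pose w (T : {set 'I_n}) : V' := r2v (\row_j x T (cast_ord dimE j)).
have wE T i : v2r (w T) 0 (cast_ord (esym dimE) i) = x T i.
  by rewrite r2vK mxE cast_ordKV.
have w0 T : w T != 0.
  have [i xTi] := x_neq0 T; apply: contraNneq xTi => wT0.
  by rewrite -wE wT0 linear0 mxE.
pose ok T (p : V * R') := [/\ p.1 != 0, p.2 != 0 & g p.1 = p.2 *: w T].
have /choice[h hP] T : exists p, ok T p.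
  by have [u [s us]] := gP _ (w0 T); exists (u, s).
(* A nonzero vector over {0, 1} is recorded by its support; this yields an
   injection of the subsets of the coordinates that misses the empty set. *)
pose code T := [set i | v2r (h T).1 0 i == 1].
have codeE T i : v2r (h T).1 0 i = (i \in code T)%:R.
  rewrite inE; case: (bin (v2r (h T).1 0 i)) => ->; rewrite ?eqxx //.
  by rewrite eq_sym oner_eq0.
have code_inj : injective code.
  move=> T1 T2 eqT; have eqh : (h T1).1 = (h T2).1.
    by apply: v2r_inj; apply/rowP => i; rewrite !codeE eqT.
  have [_ s1 g1] := hP T1; have [_ s2 g2] := hP T2.
  apply: (x_prop _ _ _ _ s1 s2) => i.
  have : v2r ((h T1).2 *: w T1) = v2r ((h T2).2 *: w T2) by rewrite -g1 -g2 eqh.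
  by rewrite !linearZ /= => /rowP/(_ (cast_ord (esym dimE) i)); rewrite !mxE !wE.
have /codomP[T T0] := injF_onto code_inj finset.set0.
have [/eqP[]] := hP T; apply: v2r_inj; rewrite linear0; apply/rowP => i.
by rewrite codeE -T0 inE mxE.
Qed.

End Counting.

(** * Lines and flats of an affine space *)

Section AffineGeometry.
Local Open Scope ring_scope.
Variables (n : nat) (A : affineSpace n).
Implicit Types (P Q X : A) (a b : line A) (u v : direction A).

Lemma translate_onto P Q : exists v, translate P v = Q.
Proof. by have [v []] := translate_simply_transitive P Q; exists v. Qed.

Lemma translate_inj P : injective (translate P).
Proof.
move=> u v uv; have [w [_ wP]] := translate_simply_transitive P (translate P u).
by rewrite -(wP u) // -(wP v).
Qed.

Lemma line_at a P : points_of a P ->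
  exists2 v, v != 0 & points_of a = line_through P v.
Proof.
rewrite /points_of => aP; have [Q [v [v0 aE]]] := set_valP a.
exists v => //; move: aP; rewrite aE => -[t ->].
rewrite funeqE => X; apply/propeqP; split=> -[s ->].
  by exists (s - t); rewrite -translateD -scalerDl addrC subrK.
by exists (t + s); rewrite -translateD -scalerDl.
Qed.

Lemma exists_line P v : v != 0 -> exists a, points_of a = line_through P v.
Proof.
move=> v0; have l : lines A (line_through P v) by exists P, v.
by exists (SigSub (mem_set l)).
Qed.

Lemma points_of_inj : injective (@points_of n A).
Proof. exact: val_inj. Qed.

Lemma line_through_base P v : line_through P v P.
Proof. by exists 0; rewrite scale0r translate0. Qed.

Lemma line_through_tip P v : line_through P v (translate P v).
Proof. by exists 1; rewrite scale1r. Qed.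

Lemma join P Q : P <> Q -> exists a, points_of a P /\ points_of a Q.
Proof.
move=> PQ; have [v vE] := translate_onto P Q.
have v0 : v != 0 by apply/eqP => v0; apply: PQ; rewrite -vE v0 translate0.
have [a aE] := exists_line P v0; exists a; rewrite aE -vE.
by split; [apply: line_through_base|apply: line_through_tip].
Qed.

Lemma line_points a P w : w != 0 -> points_of a P -> points_of a (translate P w) ->
  points_of a = line_through P w.
Proof.
move=> w0 /line_at[v v0 ->] [t /translate_inj wE].
have t0 : t != 0 by apply: contraNneq w0 => t0; rewrite wE t0 scale0r.
have tU := scalar_division t0.
rewrite funeqE => X; apply/propeqP; split=> -[s ->].
  by exists (s * t^-1); rewrite wE scalerA divrK.
by exists (s * t); rewrite wE scalerA.
Qed.

Lemma line_unique a b P Q : P <> Q -> points_of a P -> points_of a Q ->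
  points_of b P -> points_of b Q -> a = b.
Proof.
move=> PQ; have [w wE] := translate_onto P Q.
have w0 : w != 0 by apply/eqP => w0; apply: PQ; rewrite -wE w0 translate0.
rewrite -wE => aP aQ bP bQ; apply: points_of_inj.
by rewrite (line_points w0 aP aQ) (line_points w0 bP bQ).
Qed.

Lemma meet_unique a b P Q : a <> b -> points_of a P -> points_of b P ->
  points_of a Q -> points_of b Q -> P = Q.
Proof.
move=> ab aP bP aQ bQ; apply: contrapT => PQ; apply: ab.
exact: line_unique PQ _ _ _ _.
Qed.

Lemma line_other_point a P : points_of a P -> exists2 Q, Q <> P & points_of a Q.
Proof.
move=> /line_at[v v0 ->]; exists (translate P v); last exact: line_through_tip.
by rewrite -[X in _ <> X]translate0 => /translate_inj/eqP; apply/negP.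
Qed.

Lemma line_point a : exists P, points_of a P.
Proof.
rewrite /points_of; have [P [v [_ ->]]] := set_valP a.
by exists P; apply: line_through_base.
Qed.

Definition flat P (W : direction A -> Prop) : set A :=
  fun Q => exists2 w, W w & Q = translate P w.

Definition linear_set (U : set A) : Prop :=
  forall a P Q, P <> Q -> points_of a P -> points_of a Q -> U P -> U Q ->
  forall X, points_of a X -> U X.

Lemma flat_linear P W : subspace W -> linear_set (flat P W).
Proof.
move=> sub a Q1 Q2 Q12 aQ1 aQ2 [w1 Ww1 Q1E] [w2 Ww2 Q2E] X.
have Q2E' : Q2 = translate Q1 (w2 - w1).
  by rewrite Q1E Q2E -translateD addrC subrK.
have w0 : w2 - w1 != 0.
  by apply/eqP => w0; apply: Q12; rewrite Q2E' w0 translate0.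
rewrite Q2E' in aQ2; rewrite (line_points w0 aQ1 aQ2) => -[t ->].
exists (w1 + t *: (w2 - w1)); last by rewrite Q1E -translateD.
by apply: subspaceD => //; apply: subspaceZ => //; apply: subspaceB.
Qed.

(** Affine combinations of two points stay on the line joining them. *)
Lemma linear_set_comb U P p q (t : scalar A) : linear_set U ->
  U (translate P p) -> U (translate P q) -> U (translate P (p + t *: (q - p))).
Proof.
move=> lin Up Uq; have [<-|/eqP pq] := eqVneq p q.
  by rewrite subrr scaler0 addr0.
have PQ : translate P p <> translate P q by move=> /translate_inj.
have [a [aP aQ]] := join PQ; apply: (lin a _ _ PQ) => //.
have qE : translate P q = translate (translate P p) (q - p).
  by rewrite -translateD addrC subrK.
rewrite qE in aQ; rewrite (line_points _ aP aQ).
  by exists t; rewrite -translateD.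
by rewrite subr_eq0 eq_sym; apply/eqP.
Qed.

(** A set closed under joining points is a flat once there is a scalar [c] other
    than 0 and 1: P + (u + v) lies on the line joining P + u/(1 - c) to P + v/c. *)
Lemma linear_set_subspace U P (c : scalar A) : c != 0 -> c != 1 ->
  linear_set U -> U P -> subspace (fun v => U (translate P v)).
Proof.
move=> c0 c1 lin UP; have U0 : U (translate P 0) by rewrite translate0.
have UZ t v : U (translate P v) -> U (translate P (t *: v)).
  by move=> Uv; have := linear_set_comb t lin U0 Uv; rewrite add0r subr0.
split=> // t u v /(UZ t); move: (t *: u) => {}u Uu Uv.
have d0 : 1 - c != 0 by rewrite subr_eq0 eq_sym.
have := linear_set_comb c lin (UZ (1 - c)^-1 _ Uu) (UZ c^-1 _ Uv).
rewrite scalerBr [c *: (c^-1 *: v)]scalerA mulrV ?scalar_division // scale1r.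
rewrite addrCA -[X in X - _]scale1r -scalerBl scalerA mulrV ?scalar_division //.
by rewrite scale1r addrC.
Qed.

Lemma direction_off_span (s : seq (direction A)) : (size s < n)%N ->
  exists2 v : direction A, v != 0 & ~ spanned s v.
Proof.
move=> szs; have [|v nsv] := @spanned_proper _ _ (@scalar_division _ A) s.
  by rewrite direction_dim.
exists v => //; apply/eqP => v0; apply: nsv; rewrite v0.
by case: (spanned_subspace s).
Qed.

(** A line parallel to a flat, through a point outside it. *)
Lemma line_off_flat P (s : seq (direction A)) u : (size s < n)%N ->
  u != 0 -> u \in s ->
  exists a, forall X, points_of a X -> ~ flat P (spanned s) X.
Proof.
move=> szs u0 us; have [w _ nsw] := direction_off_span szs.
have [a aE] := exists_line (translate P w) u0; exists a => X.
rewrite aE => -[t ->]; rewrite -translateD => -[v sv /translate_inj wE].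
apply: nsw; rewrite -[w](addrK (t *: u)) wE.
have sub := spanned_subspace s.
by apply: (subspaceB sub sv); apply: (subspaceZ _ sub); apply: mem_spanned.
Qed.

End AffineGeometry.

(** * Maps of lines that preserve intersection *)

Section IntersectionPreserving.
Local Open Scope ring_scope.
Variables (n : nat) (A A' : affineSpace n) (f : line A -> line A').
Hypothesis hn : (3 <= n)%N.
Hypothesis f_surj : forall b : line A', exists a : line A, f a = b.
Hypothesis f_meets : forall a b : line A, meets a b -> meets (f a) (f b).

Lemma two_lines_through (P : A) :
  exists a b, [/\ a <> b, points_of a P & points_of b P].
Proof.
have [|u u0 _] := @direction_off_span n A [::]; first exact: leq_trans hn.
have [|v v0 nv] := @direction_off_span n A [:: u]; first exact: leq_trans hn.
have [a aE] := exists_line P u0; have [b bE] := exists_line P v0.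
exists a, b; split; rewrite ?aE ?bE; try exact: line_through_base.
move=> ab; have := line_through_tip P v; rewrite -bE -ab aE.
move=> [t /translate_inj vE]; apply: nv; rewrite vE.
apply: (subspaceZ _ (spanned_subspace _)).
by apply: mem_spanned; rewrite inE.
Qed.

(** Lines through [P] have pairwise intersecting images. These cannot all lie in
    the plane E of two of them, for then the image of every line would meet E;
    and a third line outside E forces all of them through one point. *)
Lemma star_to_star (P : A) :
  exists P', forall c, points_of c P -> points_of (f c) P'.
Proof.
have [a [b [ab aP bP]]] := two_lines_through P.
have [fab [P' [aP' bP']]] : meets (f a) (f b).
  by apply: f_meets; split=> //; exists P.
exists P'.
have [u u0 aE] := line_at aP'; have [v v0 bE] := line_at bP'.
pose E := flat P' (spanned [:: u; v]).
have sub := spanned_subspace [:: u; v].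
have Elin : linear_set E by apply: flat_linear.
have aE' X : points_of (f a) X -> E X.
  rewrite aE => -[t ->]; exists (t *: u) => //.
  by apply: (subspaceZ _ sub); apply: mem_spanned; rewrite inE eqxx.
have bE' X : points_of (f b) X -> E X.
  rewrite bE => -[t ->]; exists (t *: v) => //.
  by apply: (subspaceZ _ sub); apply: mem_spanned; rewrite !inE eqxx orbT.
(* A line meeting both f a and f b away from P' has two points in E. *)
have planar l : meets l (f a) -> meets l (f b) -> ~ points_of l P' ->
    forall X, points_of l X -> E X.
  move=> [_ [Y [lY aY]]] [_ [Z [lZ bZ]]] nlP' X.
  have YZ : Y <> Z.
    by move=> YZ; subst Z; apply: nlP'; rewrite (meet_unique fab aP' bP' aY bZ).
  by apply: (Elin l Y Z) => //; [apply: aE'|apply: bE'].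
have star_meets c d : points_of c P -> points_of d P -> c <> d ->
  meets (f c) (f d) by move=> cP dP cd; apply: f_meets; split=> //; exists P.
(* The star of P is not mapped into the plane E. *)
have [c [cP [Z [cZ nEZ]]]] : exists c, points_of c P /\
    exists Z, points_of (f c) Z /\ ~ E Z.
  apply: contrapT => all_planar.
  have starE c X : points_of c P -> points_of (f c) X -> E X.
    move=> cP cX; apply: contrapT => nEX; apply: all_planar.
    by exists c; split=> //; exists X.
  have [|l lE] := @line_off_flat _ A' P' [:: u; v] u hn u0.
    by rewrite inE eqxx.
  have [d dl] := f_surj l.
  have [dP|ndP] := pselect (points_of d P).
    have [X lX] := line_point l; apply: (lE X) => //.
    by apply: (starE d) => //; rewrite dl.
  have [X dX] := line_point d.
  have PX : P <> X by move=> PX; apply: ndP; rewrite PX.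
  have [c [cP cX]] := join PX.
  have [_ [Y [dY cY]]] : meets (f d) (f c).
    apply: f_meets; split; last by exists X.
    by move=> dc; apply: ndP; rewrite dc.
  by apply: (lE Y); [rewrite -dl|apply: (starE c)].
have ca : c <> a by move=> ca; subst c; apply: nEZ; apply: aE'.
have cb : c <> b by move=> cb; subst c; apply: nEZ; apply: bE'.
have cP' : points_of (f c) P'.
  apply: contrapT => ncP'; apply: nEZ.
  by apply: (planar (f c)) => //; apply: star_meets.
move=> d dP; apply: contrapT => ndP'.
have da : d <> a by move=> da; apply: ndP'; rewrite da.
have db : d <> b by move=> db; apply: ndP'; rewrite db.
have dc : d <> c by move=> dc; apply: ndP'; rewrite dc.
have dE : forall X, points_of (f d) X -> E X.
  by apply: planar => //; apply: star_meets.
have [_ [Y [dY cY]]] := star_meets _ _ dP cP dc.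
have YP' : Y <> P' by move=> YP'; apply: ndP'; rewrite -YP'.
apply: nEZ; apply: (Elin _ _ _ YP' cY cP') => //; first exact: dE.
exact: aE'.
Qed.

Variable kappa : A -> A'.
Hypothesis kappaP :
  forall P c, points_of c P -> points_of (f c) (kappa P).

(** If two points had the same image, all points off their join, and then all
    lines, would be sent to this image point. *)
Lemma kappa_inj : injective kappa.
Proof.
move=> P Q PQ; apply: contrapT => neqPQ.
have [l [lP lQ]] := join neqPQ.
(* Two distinct lines pass through both kappa X and kappa P. *)
have off X : ~ points_of l X -> kappa X = kappa P.
  move=> nlX.
  have XP : X <> P by move=> XP; apply: nlX; rewrite XP.
  have XQ : X <> Q by move=> XQ; apply: nlX; rewrite XQ.
  have [a [aX aP]] := join XP; have [b [bX bQ]] := join XQ.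
  have [fab _] : meets (f a) (f b).
    apply: f_meets; split; last by exists X.
    by move=> ab; apply: nlX; rewrite (line_unique neqPQ lP lQ aP) // ab.
  apply: (meet_unique fab); try exact: kappaP.
  by rewrite PQ; apply: kappaP.
have all_through a : points_of (f a) (kappa P).
  have [al|al] := pselect (a = l); first by rewrite al; apply: kappaP.
  have [X aX] := line_point a.
  have [lX|/off<-] := pselect (points_of l X); last exact: kappaP.
  have [Y YX aY] := line_other_point aX.
  rewrite -(off Y); first exact: kappaP.
  by move=> lY; apply: al; apply: line_unique YX _ _ _ _.
have [|u u0 _] := @direction_off_span n A' [::]; first exact: leq_trans hn.
have [|l' l'E] := @line_off_flat _ A' (kappa P) [:: u] u _ u0 (mem_head _ _).
  exact: leq_trans hn.
have [a al'] := f_surj l'.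
apply: (l'E (kappa P)); first by rewrite -al'.
exists 0; last by rewrite translate0.
by case: (spanned_subspace [:: u]).
Qed.

(** Otherwise [f a] would also be the image of a line joining [X] to a point of
    [a], although that line meets [a]. *)
Lemma kappa_reflects X a : points_of (f a) (kappa X) -> points_of a X.
Proof.
move=> aX; apply: contrapT => naX; have [Y aY] := line_point a.
have XY : X <> Y by move=> XY; apply: naX; rewrite XY.
have [b [bX bY]] := join XY.
have [fab _] : meets (f a) (f b).
  apply: f_meets; split; last by exists Y.
  by move=> ab; apply: naX; rewrite ab.
apply: fab; apply: (@line_unique _ _ _ _ (kappa X) (kappa Y)) => //.
- by move=> /kappa_inj.
- exact: kappaP.
- exact: kappaP.
- exact: kappaP.
Qed.

Lemma f_inj : injective f.
Proof.
move=> a b fab; have [X aX] := line_point a.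
have [Y YX aY] := line_other_point aX.
by apply: (line_unique YX) => //; apply: kappa_reflects; rewrite -fab; apply: kappaP.
Qed.

Lemma preimage_linear U : linear_set U -> linear_set (fun P => U (kappa P)).
Proof.
move=> lin a P Q PQ aP aQ UP UQ X aX.
apply: (lin (f a) (kappa P) (kappa Q)) => //; try exact: kappaP.
by move=> /kappa_inj.
Qed.

(** Each line through [kappa X] is the image of a line through [X], so the source
    has at least as many directions as the target. *)
Lemma scalar_not_binary (c : scalar A') : c != 0 -> c != 1 ->
  exists t : scalar A, t != 0 /\ t != 1.
Proof.
move=> c0 c1; apply: contrapT => /forallNP/= bin.
have [X] := point_nonempty A.
have /choice[g gP] u : exists v, translate (kappa X) v = kappa (translate X u).
  exact: translate_onto.
apply: (@no_binary_star _ _ (direction A) (direction A') c g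
  (@scalar_division _ A')) => //.
- by rewrite !direction_dim.
- by rewrite direction_dim; apply: leq_trans hn.
- move=> t; have [->|t0] := eqVneq t 0; first by left.
  have [->|t1] := eqVneq t 1; first by right.
  by case: (bin t).
move=> w w0; have [l lE] := exists_line (kappa X) w0.
have [a al] := f_surj l.
have aX : points_of a X.
  by apply: kappa_reflects; rewrite al lE; apply: line_through_base.
have [Y YX aY] := line_other_point aX; have [u uE] := translate_onto X Y.
have := kappaP aY; rewrite al lE => -[s sE].
have Ysw : translate (kappa X) (s *: w) <> kappa X by rewrite -sE => /kappa_inj.
exists u, s; split.
- by apply/eqP => u0; apply: YX; rewrite -uE u0 translate0.
- by apply/eqP => s0; apply: Ysw; rewrite s0 scale0r translate0.
- by apply: (@translate_inj _ _ (kappa X)); rewrite gP uE.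
Qed.

(** A line of the target has exactly two points, and contains two points of the
    range of [kappa]. *)
Lemma kappa_onto_binary (P' : A') :
  (forall t : scalar A', t = 0 \/ t = 1) -> exists X, kappa X = P'.
Proof.
move=> bin; have [|u u0 _] := @direction_off_span n A' [::].
  exact: leq_trans hn.
have [l lE] := exists_line P' u0; have [a al] := f_surj l.
have [X aX] := line_point a; have [Y YX aY] := line_other_point aX.
have := kappaP aX; rewrite al lE => -[t tE].
have := kappaP aY; rewrite al lE => -[s sE].
have XY : kappa Y <> kappa X by move=> /kappa_inj.
case: (bin t) tE => -> tE; first by exists X; rewrite tE scale0r translate0.
case: (bin s) sE => -> sE; first by exists Y; rewrite sE scale0r translate0.
by case: XY; rewrite tE.
Qed.

(** A missed point [P'] makes the preimage of a plane through [P'] contain three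
    independent directions, whence the range of [kappa] lies in a proper flat. *)
Lemma kappa_onto_ternary (c : scalar A) (P' : A') :
  c != 0 -> c != 1 -> exists X, kappa X = P'.
Proof.
move=> c0 c1; apply: contrapT => /forallNP/= missed.
have [|u' u'0 _] := @direction_off_span n A' [::]; first exact: leq_trans hn.
have [|w _ nw] := @direction_off_span n A' [:: u']; first exact: leq_trans hn.
have nwu t : w <> t *: u'.
  move=> wE; apply: nw; rewrite wE; apply: (subspaceZ _ (spanned_subspace _)).
  exact: mem_spanned (mem_head _ _).
have [l1 l1E] := exists_line P' u'0.
have [l2 l2E] := exists_line (translate P' w) u'0.
have [a1 fa1] := f_surj l1; have [b fb] := f_surj l2.
have disj Q : points_of l1 Q -> points_of l2 Q -> False.
  rewrite l1E l2E => -[t ->] [s]; rewrite -translateD => /translate_inj eq.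
  by apply: (nwu (t - s)); rewrite scalerBl eq addrK.
have l1P' : points_of l1 P' by rewrite l1E; apply: line_through_base.
have [X bX] := line_point b.
have l2X : points_of l2 (kappa X) by rewrite -fb; apply: kappaP.
have P'X : P' <> kappa X by move=> /esym/missed.
have [l3 [l3P' l3X]] := join P'X; have [b' fb'] := f_surj l3.
have b'X : points_of b' X by apply: kappa_reflects; rewrite fb'.
have l31 : l3 <> l1 by move=> l31; apply: (disj (kappa X)); rewrite // -l31.
have l32 : l3 <> l2 by move=> l32; apply: (disj P'); rewrite // -l32.
have b'b : b' <> b by move=> b'b; apply: l32; rewrite -fb -fb' b'b.
have b_a1 Y : points_of b Y -> points_of a1 Y -> False.
  by move=> /kappaP + /kappaP; rewrite fb fa1 => bY aY; apply: disj aY bY.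
have b'_a1 Y : points_of b' Y -> points_of a1 Y -> False.
  move=> /kappaP + /kappaP; rewrite fb' fa1 => bY aY.
  by apply: (missed Y); apply: (meet_unique l31).
pose E := flat P' (spanned [:: u'; w]).
have Esub := spanned_subspace [:: u'; w].
have Elin : linear_set E by apply: flat_linear.
have Eu t : spanned [:: u'; w] (t *: u').
  by apply: (subspaceZ _ Esub); apply: mem_spanned; rewrite inE eqxx.
have l1inE Q : points_of l1 Q -> E Q.
  by rewrite l1E => -[t ->]; exists (t *: u').
have l2inE Q : points_of l2 Q -> E Q.
  rewrite l2E => -[t ->]; rewrite -translateD; exists (w + t *: u') => //.
  by apply: (subspaceD Esub) => //; apply: mem_spanned; rewrite !inE eqxx orbT.
have l3inE Q : points_of l3 Q -> E Q.
  apply: (Elin _ _ _ P'X) => //; [exact: l1inE|exact: l2inE].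
pose D v := E (kappa (translate X v)).
have Dsub : subspace D.
  apply: (linear_set_subspace c0 c1) (preimage_linear Elin) _.
  exact: l2inE.
have [v1 v10 bE] := line_at bX; have [v2 v20 b'E] := line_at b'X.
have [Y a1Y] := line_point a1; have [u u0 a1E] := line_at a1Y.
have [z zE] := translate_onto X Y.
have onD a v : points_of a (translate X v) ->
    (forall Q, points_of (f a) Q -> E Q) -> D v.
  by move=> av; apply; apply: kappaP.
have Dv1 : D v1.
  by apply: (onD b); rewrite ?fb // bE; apply: line_through_tip.
have Dv2 : D v2.
  by apply: (onD b'); rewrite ?fb' // b'E; apply: line_through_tip.
have Dz : D z by apply: (onD a1); rewrite ?fa1 // zE.
have Du : D u.
  rewrite -[u](addKr z) addrC; apply: (subspaceB Dsub) => //.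
  apply: (onD a1); rewrite ?fa1 // translateD zE a1E.
  exact: line_through_tip.
have free21 : independent [:: v2; v1].
  split; last first.
    by split=> // /spanned_nil/eqP; rewrite (negPf v10).
  move=> /spanned1[t v2E]; apply: b'b.
  have Xv2 : X <> translate X v2.
    by rewrite -[X in X <> _]translate0 => /translate_inj/esym/eqP; apply/negP.
  apply: (line_unique Xv2) => //.
    by rewrite b'E; apply: line_through_tip.
  by rewrite bE; exists t; rewrite v2E.
(* If D were spanned by v1 and v2, the line a1 would lie in the plane of b and
   b' and would meet one of them. *)
have [p [Dp np]] : exists p, D p /\ ~ spanned [:: v2; v1] p.
  apply: contrapT => /forallNP/= D2.
  have coord v : D v -> exists s t, v = s *: v2 + t *: v1.
    move=> Dv; have /contrapT : ~ ~ spanned [:: v2; v1] v.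
      by move=> nv; apply: (D2 v).
    by move=> /spanned_cons[s [_ [/spanned1[t ->] ->]]]; exists s, t.
  have [al [be uE]] := coord u Du; have [ga [de zE']] := coord z Dz.
  have a1_pt t : points_of a1
      (translate X ((ga + t * al) *: v2 + (de + t * be) *: v1)).
    rewrite !scalerDl addrACA -zE' -!scalerA -scalerDr -uE translateD zE a1E.
    by exists t.
  (* At most one of b and b' is parallel to a1; t is chosen so that the
     coefficient of v2, respectively of v1, vanishes. *)
  have [be0|be0] := eqVneq be 0.
    have al0 : al != 0.
      by apply: contraNneq u0 => al0; rewrite uE al0 be0 !scale0r addr0.
    apply: (b_a1 _ _ (a1_pt (- ga * al^-1))).
    rewrite divrK ?scalar_division // subrr scale0r add0r bE.
    by eexists.
  apply: (b'_a1 _ _ (a1_pt (- de * be^-1))).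
  rewrite divrK ?scalar_division // subrr scale0r addr0 b'E.
  by eexists.
have [|t [szt tV]] := @complete_basis _ _ (@scalar_division _ A) (p :: [:: v2; v1]).
  by [].
have /choice[q qP] v : exists v', translate P' v' = kappa (translate X v).
  exact: translate_onto.
(* Only n - 1 directions: the three independent vectors p, v2, v1 of D are
   accounted for by u' and w. *)
pose s' := u' :: w :: map q t.
have szs' : (size s' < n)%N.
  by rewrite /= size_map; apply: eq_leq; move: szt; rewrite direction_dim.
have [m mE] := line_off_flat P' szs' u'0 (mem_head _ _).
have [d dm] := f_surj m; have [Z dZ] := line_point d.
apply: (mE (kappa Z)); first by rewrite -dm; apply: kappaP.
have E_s' Q : E Q -> flat P' (spanned s') Q.
  move=> [v sv ->]; exists v => //; apply: spanned_sub sv => x.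
  by rewrite !inE => /orP[]->; rewrite ?orbT.
have [y <-] := translate_onto X Z.
have sub' : subspace (fun v => flat P' (spanned s') (kappa (translate X v))).
  have flat_lin : linear_set (flat P' (spanned s')).
    exact/flat_linear/spanned_subspace.
  apply: (linear_set_subspace c0 c1 (preimage_linear flat_lin)).
  by apply: E_s'; apply: l2inE.
apply: (tV y _ sub') => v; rewrite mem_cat => /orP[|vt].
  by rewrite !inE => /or3P[]/eqP->; apply: E_s'.
exists (q v) => //; apply: mem_spanned.
by rewrite !inE (map_f q vt) !orbT.
Qed.

Lemma kappa_onto (P' : A') : exists X, kappa X = P'.
Proof.
have [[c [c0 c1]]|bin] := pselect (exists c : scalar A', c != 0 /\ c != 1).
  have [t [t0 t1]] := scalar_not_binary c0 c1.
  exact: kappa_onto_ternary t0 t1.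
apply: kappa_onto_binary => t.
have [->|t0] := eqVneq t 0; first by left.
have [->|t1] := eqVneq t 1; first by right.
by case: bin; exists t.
Qed.

Lemma image_line a : points_of (f a) = (kappa @` points_of a)%classic.
Proof.
rewrite funeqE => Q; apply/propeqP; split=> [aQ|[X aX <-]]; last exact: kappaP.
by have [X XQ] := kappa_onto Q; exists X => //; apply: kappa_reflects; rewrite XQ.
Qed.

Lemma kappa_collineation : collineation kappa.
Proof.
have /choice[k kK] := kappa_onto.
have kK' : cancel kappa k by move=> X; apply: kappa_inj.
exists k; split=> // l ll.
  have := image_line (SigSub (mem_set ll)); rewrite {2}/points_of /= => <-.
  exact: set_valP.
have [a fa] := f_surj (SigSub (mem_set ll)).
have lE : l = points_of (f a) by rewrite fa.
suff -> : (k @` l)%classic = points_of a by exact: set_valP.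
rewrite lE image_line; apply/seteqP.
split=> [_ [_ [X aX <-] <-]|X aX]; first by rewrite kK'.
by exists (kappa X); [exists X|rewrite kK'].
Qed.

End IntersectionPreserving.

Theorem mainTheorem5 (n : nat) (hn : 3 <= n) (A A' : affineSpace n)
    (f : line A -> line A')
    (f_surj : forall b : line A', exists a : line A, f a = b)
    (f_meets : forall a b : line A, meets a b -> meets (f a) (f b)) :
  injective f /\
  exists kappa : A -> A', collineation kappa /\ stems_from f kappa.
Proof.
have /choice[kappa kappaP] := star_to_star hn f_surj f_meets.
split; first exact: f_inj kappaP.
exists kappa; split; first exact: kappa_collineation kappaP.
exact: image_line kappaP.
Qed.
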